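(* The properties $\mathrm{INC}$ and $\neg\mathrm{INC}$ of abstract rewrite systems are not generalised first-order properties.
   Context: An ARS is a pair $(A,\to)$, $A$ non-empty, ${\to}\subseteq A\times A$. It is increasing (INC) if there is a map $f:A\to\mathbb{N}$ with $f(a)<f(b)$ whenever $a\to b$. $\neg\mathrm{INC}$ is the property of not being increasing. A property $P$ is a generalised first-order property if there is a set $\Phi$ of sentences of first-order logic with equality and a binary predicate symbol $\to$ (interpreted as the one-step relation) such that for every ARS $\mathcal{A}$, $\mathcal{A}$ has $P$ iff $\mathcal{A}\models\Phi$. *)

(* Defs.v *)
From Stdlib Require Import Arith.

Record ARS := mkARS {
  carrier :> Type;
  carrier_nonempty : inhabited carrier;
  step : carrier -> carrier -> Prop
}.

Arguments step {_} _ _.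

Definition INC (A : ARS) : Prop :=
  exists f : A -> nat, forall a b : A, step a b -> f a < f b.

Definition not_INC (A : ARS) : Prop := ~ INC A.

(* Formulas over the signature with equality and one binary predicate symbol;
   variables are named by natural numbers. *)
Inductive formula : Type :=
  | fEq (x y : nat)
  | fStep (x y : nat)
  | fBot
  | fNot (phi : formula)
  | fAnd (phi psi : formula)
  | fOr (phi psi : formula)
  | fImp (phi psi : formula)
  | fAll (x : nat) (phi : formula)
  | fEx (x : nat) (phi : formula).

Fixpoint free_in (z : nat) (phi : formula) : Prop :=
  match phi with
  | fEq x y | fStep x y => z = x \/ z = y
  | fBot => False
  | fNot p => free_in z p
  | fAnd p q | fOr p q | fImp p q => free_in z p \/ free_in z q
  | fAll x p | fEx x p => z <> x /\ free_in z p
  end.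

Definition sentence (phi : formula) : Prop := forall z : nat, ~ free_in z phi.

Definition update {T : Type} (v : nat -> T) (x : nat) (a : T) : nat -> T :=
  fun y => if Nat.eqb y x then a else v y.

Fixpoint sat (A : ARS) (v : nat -> A) (phi : formula) : Prop :=
  match phi with
  | fEq x y => v x = v y
  | fStep x y => step (v x) (v y)
  | fBot => False
  | fNot p => ~ sat A v p
  | fAnd p q => sat A v p /\ sat A v q
  | fOr p q => sat A v p \/ sat A v q
  | fImp p q => sat A v p -> sat A v q
  | fAll x p => forall a : A, sat A (update v x a) p
  | fEx x p => exists a : A, sat A (update v x a) p
  end.

(* The truth of a sentence does not depend on the valuation, and the carrier
   is non-empty, so quantifying over all valuations is harmless. *)
Definition models (A : ARS) (phi : formula) : Prop :=
  forall v : nat -> A, sat A v phi.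

Definition generalised_first_order (P : ARS -> Prop) : Prop :=
  exists Phi : formula -> Prop,
    (forall phi, Phi phi -> sentence phi) /\
    (forall A : ARS, P A <-> (forall phi, Phi phi -> models A phi)).

(* Main.v *)
Require Import Defs.
From Stdlib Require Import ZArith Lia Classical.

(** The successor ARS on [nat] is increasing, whereas its disjoint union with
    the successor ARS on [Z] is not, because of the infinite backward path in
    [Z].  The two systems are elementarily equivalent: in an
    Ehrenfeucht-Fraisse game the duplicator only has to preserve signed
    distances up to a radius that is halved in every round.  The origin of the
    [nat]-line is kept among the chosen points from the beginning, so that
    closeness to the left end is preserved as well.  Hence no set of sentences
    separates the two systems. *)

(** * Line systems, signed offsets and the invariant of the game *)

Open Scope Z_scope.

(* [comp a = false] places [a] on the half-line, [comp a = true] on the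
   two-way infinite line, which may be absent. *)
Record line_system (A : ARS) := {
  comp : A -> bool;
  pos : A -> Z;
  origin : A;
  comp_origin : comp origin = false;
  pos_origin : pos origin = 0;
  loc_inj : forall a b, comp a = comp b -> pos a = pos b -> a = b;
  pos_ge0 : forall a, comp a = false -> 0 <= pos a;
  half_line_point : forall z, 0 <= z -> exists a, comp a = false /\ pos a = z;
  full_line_point : forall a z, comp a = true ->
    exists b, comp b = true /\ pos b = z;
  step_loc : forall a b, step a b <-> comp a = comp b /\ pos b = pos a + 1
}.

Arguments comp {A} _ _.
Arguments pos {A} _ _.
Arguments origin {A} _.

(** A relation rather than a function, since points on different lines have no distance. *)
Definition offset {A} (L : line_system A) (a b : A) (d : Z) : Prop :=
  comp L a = comp L b /\ pos L b = pos L a + d.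

(** The duplicator's invariant for the chosen pairs [R]. The bound stands in for finiteness of [R]:
    it leaves room on the half-line beyond all chosen points. *)
Record locally_similar {A B} (L : line_system A) (M : line_system B)
    (n : Z) (R : A -> B -> Prop) : Prop := {
  similar_origin : R (origin L) (origin M);
  similar_bounded : exists K, forall a b, R a b -> pos L a <= K /\ pos M b <= K;
  similar_offset : forall a b a' b' d, R a b -> R a' b' -> -n <= d <= n ->
    (offset L a a' d <-> offset M b b' d)
}.

Definition add_pair {A B : Type} (R : A -> B -> Prop) (a : A) (b : B) :
  A -> B -> Prop := fun x y => R x y \/ (x = a /\ y = b).

Lemma locally_similar_flip {A B} (L : line_system A) (M : line_system B) n R :
  locally_similar L M n R -> locally_similar M L n (fun b a => R a b).
Proof.
  intros [H0 [K HK] Hd]; split.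
  - exact H0.
  - exists K; intros b a H; destruct (HK _ _ H); auto.
  - intros; symmetry; apply Hd; auto.
Qed.

Lemma offset_sym {A} (L : line_system A) a b d :
  offset L a b d <-> offset L b a (- d).
Proof. unfold offset; split; intros [-> ->]; split; auto; lia. Qed.

Lemma offset_origin {A} (L : line_system A) a d :
  offset L (origin L) a d <-> comp L a = false /\ pos L a = d.
Proof.
  unfold offset; rewrite comp_origin, pos_origin.
  split; intros [H1 H2]; split; auto.
Qed.

Lemma offset_shift {A} (L : line_system A) a b c e d :
  offset L a b e -> (offset L b c d <-> offset L a c (e + d)).
Proof.
  unfold offset; intros [-> ->]; split; intros [H1 H2]; split; auto; lia.
Qed.

Lemma offset_eq {A} (L : line_system A) a b : a = b <-> offset L a b 0.
Proof.
  unfold offset; split; [intros -> | intros [H1 H2]].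
  - split; auto; lia.
  - apply (loc_inj _ L); auto; lia.
Qed.

(** Two old pairs are covered by radius [m]; a new and an old pair by the hypothesis, up to the sign
    of [d]; the new pair against itself admits only the offset 0. *)
Lemma locally_similar_add {A B} (L : line_system A) (M : line_system B) n m R a b :
  n <= m -> locally_similar L M m R ->
  (forall a' b' d, R a' b' -> -n <= d <= n ->
     (offset L a a' d <-> offset M b b' d)) ->
  locally_similar L M n (add_pair R a b).
Proof.
  intros Hnm [H0 [K HK] Hd] Hab; split.
  - left; exact H0.
  - exists (Z.max K (Z.max (pos L a) (pos M b))).
    intros x y [H | [-> ->]]; [destruct (HK _ _ H) | ]; lia.
  - intros x y x' y' d [H | [-> ->]] [H' | [-> ->]] Hdn.
    + apply Hd; auto; lia.
    + rewrite (offset_sym L), (offset_sym M); apply Hab; auto; lia.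
    + apply Hab; auto.
    + unfold offset; split; intros [_ H2]; split; auto; lia.
Qed.

(** If [a] is within [n] of a chosen point, its offset is copied, and offsets up to [n] from [a]
    become offsets up to [2 * n] from that point. Otherwise [b] is placed far from all chosen
    points. *)
Lemma locally_similar_forth {A B} (L : line_system A) (M : line_system B) n m R a :
  0 <= n -> 2 * n <= m -> locally_similar L M m R ->
  exists b, locally_similar L M n (add_pair R a b).
Proof.
  intros Hn Hnm HR.
  pose proof (similar_origin _ _ _ _ HR) as H0.
  pose proof (similar_offset _ _ _ _ HR) as Hd.
  destruct (classic (exists a0 b0 e, R a0 b0 /\ -n <= e <= n /\ offset L a0 a e))
    as [(a0 & b0 & e & HR0 & He & Hoff) | Hfar].
  - assert (Hb : exists b, offset M b0 b e).
    { destruct (comp M b0) eqn:Hc.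
      - destruct (full_line_point _ M b0 (pos M b0 + e) Hc) as (b & Hb1 & Hb2).
        exists b; split; congruence.
      - pose proof (pos_ge0 _ M b0 Hc).
        destruct (Z_lt_le_dec (pos M b0 + e) 0) as [Hneg | Hpos].
        + (* [b0] is then so close to the origin that [a0] has the same position *)
          exfalso.
          assert (Ha0 : offset L (origin L) a0 (pos M b0)).
          { apply (Hd _ _ _ _ _ H0 HR0); [lia | apply offset_origin; auto]. }
          apply offset_origin in Ha0 as [Hca0 Hpa0].
          destruct Hoff as [Hca Hpa].
          pose proof (pos_ge0 _ L a ltac:(congruence)); lia.
        + destruct (half_line_point _ M _ Hpos) as (b & Hb1 & Hb2).
          exists b; split; congruence. }
    destruct Hb as [b Hb]; exists b.
    apply (locally_similar_add _ _ n m); auto; [lia | ].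
    intros a' b' d HR' Hdn.
    rewrite (offset_shift L _ _ _ _ _ Hoff), (offset_shift M _ _ _ _ _ Hb).
    apply Hd; auto; lia.
  - destruct (similar_bounded _ _ _ _ HR) as [K HK].
    destruct (HK _ _ H0) as [_ HK0]; rewrite pos_origin in HK0.
    (* This point is more than [n] to the right of every chosen one, and [0 <= K] because the origin
       is chosen. The half-line serves even when [a] is on a full line, which [M] may lack. *)
    destruct (half_line_point _ M (K + n + 1) ltac:(lia)) as (b & Hb1 & Hb2).
    exists b; apply (locally_similar_add _ _ n m); auto; [lia | ].
    intros a' b' d HR' Hdn; split; intros Hoff; exfalso.
    + apply Hfar; exists a', b', (- d).
      split; [auto | split; [lia | apply offset_sym in Hoff; exact Hoff]].
    + destruct Hoff as [_ Hp], (HK _ _ HR'); lia.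
Qed.

Lemma locally_similar_back {A B} (L : line_system A) (M : line_system B) n m R b :
  0 <= n -> 2 * n <= m -> locally_similar L M m R ->
  exists a, locally_similar L M n (add_pair R a b).
Proof.
  intros Hn Hnm HR.
  destruct (locally_similar_forth M L n m _ b Hn Hnm
              (locally_similar_flip _ _ _ _ HR)) as [a Ha].
  exists a; apply locally_similar_flip in Ha.
  (* The flipped [add_pair] matches the wanted one only up to swapping a conjunction, so the fields
     are rebuilt. *)
  destruct Ha as [H0 [K HK] Hd]; unfold add_pair in *; split.
  - tauto.
  - exists K; intros x y H; apply HK; tauto.
  - intros x y x' y' d H H'; apply Hd; tauto.
Qed.

(** * Transfer of formulas between line systems *)

Fixpoint radius (phi : formula) : Z :=
  match phi with
  | fEq _ _ | fStep _ _ | fBot => 1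
  | fNot p => radius p
  | fAnd p q | fOr p q | fImp p q => Z.max (radius p) (radius q)
  | fAll _ p | fEx _ p => 2 * radius p
  end.

Lemma radius_ge1 phi : 1 <= radius phi.
Proof. induction phi; cbn [radius]; lia. Qed.

Lemma add_pair_update {A B : Type} (R : A -> B -> Prop) v w x phi a b :
  (forall z, z <> x /\ free_in z phi -> R (v z) (w z)) ->
  forall z, free_in z phi -> add_pair R a b (update v x a z) (update w x b z).
Proof.
  intros H z Hz; unfold update, add_pair.
  destruct (Nat.eqb_spec z x); auto.
Qed.

(** Equality and step are the offsets 0 and 1, within any radius at least 1. Each quantifier is one
    round of the game, paid for by halving the radius. *)
Lemma sat_locally_similar {A B} (L : line_system A) (M : line_system B) phi :
  forall n R v w, radius phi <= n -> locally_similar L M n R ->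
  (forall z, free_in z phi -> R (v z) (w z)) ->
  (sat A v phi <-> sat B w phi).
Proof.
  induction phi as [x y|x y| |p IH|p IHp q IHq|p IHp q IHq|p IHp q IHq|x p IH|x p IH];
    intros n R v w Hn HR Hf; simpl in *.
  - rewrite (offset_eq L), (offset_eq M).
    apply (similar_offset _ _ _ _ HR); auto; lia.
  - rewrite (step_loc _ L), (step_loc _ M).
    apply (similar_offset _ _ _ _ HR); auto; lia.
  - tauto.
  - rewrite (IH n R v w); auto; tauto.
  - rewrite (IHp n R v w), (IHq n R v w); auto; try tauto; lia.
  - rewrite (IHp n R v w), (IHq n R v w); auto; try tauto; lia.
  - rewrite (IHp n R v w), (IHq n R v w); auto; try tauto; lia.
  - pose proof (radius_ge1 p).
    split; intros Hs c.
    + destruct (locally_similar_back L M (radius p) n R c) as [a Ha]; auto; [lia | ].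
      apply (IH _ _ (update v x a) _ (Z.le_refl _) Ha); auto.
      apply add_pair_update, Hf.
    + destruct (locally_similar_forth L M (radius p) n R c) as [b Hb]; auto; [lia | ].
      apply (IH _ _ _ (update w x b) (Z.le_refl _) Hb); auto.
      apply add_pair_update, Hf.
  - pose proof (radius_ge1 p).
    split; intros [c Hs].
    + destruct (locally_similar_forth L M (radius p) n R c) as [b Hb]; auto; [lia | ].
      exists b; apply (IH _ _ (update v x c) _ (Z.le_refl _) Hb); auto.
      apply add_pair_update, Hf.
    + destruct (locally_similar_back L M (radius p) n R c) as [a Ha]; auto; [lia | ].
      exists a; apply (IH _ _ _ (update w x c) (Z.le_refl _) Ha); auto.
      apply add_pair_update, Hf.
Qed.

Lemma models_line_system {A B} (L : line_system A) (M : line_system B) phi :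
  sentence phi -> models A phi -> models B phi.
Proof.
  intros Hs HA w.
  (* The game starts with only the origins paired; a sentence has no free variables, so any
     valuation into [A] will do. *)
  apply (sat_locally_similar L M phi (radius phi)
           (fun a b => a = origin L /\ b = origin M) (fun _ => origin L) w).
  - lia.
  - split.
    + auto.
    + exists 0; intros a b [-> ->]; rewrite !pos_origin; lia.
    + intros a b a' b' d [-> ->] [-> ->] _.
      rewrite !offset_origin, !comp_origin, !pos_origin; tauto.
  - intros z Hz; destruct (Hs z Hz).
  - apply HA.
Qed.

Lemma generalised_first_order_line_system P {A B} :
  generalised_first_order P -> line_system A -> line_system B -> P A -> P B.
Proof.
  intros (Phi & Hsent & HP) L M HA.
  apply HP; intros phi Hphi.
  apply (models_line_system L M); auto.
  apply HP; auto.
Qed.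

(** * The two separating systems *)

Definition nat_ars : ARS :=
  mkARS nat (inhabits 0%nat) (fun a b => b = S a).

Definition nat_Z_ars : ARS :=
  mkARS (nat + Z) (inhabits (inl 0%nat))
    (fun a b => match a, b with
                | inl m, inl n => n = S m
                | inr y, inr z => z = y + 1
                | _, _ => False
                end).

Definition nat_line_system : line_system nat_ars.
Proof.
  refine {| comp := fun _ : nat_ars => false;
            pos := fun n : nat_ars => Z.of_nat n;
            origin := 0%nat : nat_ars |}; simpl; auto.
  - intros; lia.
  - intros; lia.
  - intros z Hz; exists (Z.to_nat z); split; auto; lia.
  - intros; discriminate.
  - intros a b; split; [split | intros []]; auto; lia.
Defined.

Definition nat_Z_line_system : line_system nat_Z_ars.
Proof.
  refine {| comp := fun p : nat_Z_ars => match p with inl _ => false | inr _ => true end;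
            pos := fun p : nat_Z_ars => match p with inl n => Z.of_nat n | inr z => z end;
            origin := inl 0%nat : nat_Z_ars |}; simpl; auto.
  - intros [m|y] [n|z] Hc Hp; try discriminate; f_equal; lia.
  - intros [m|y] Hc; [lia | discriminate].
  - intros z Hz; exists (inl (Z.to_nat z)); split; auto; lia.
  - intros _ z _; exists (inr z); auto.
  - intros [m|y] [n|z]; (split; [intros H | intros [Hc Hp]]);
      first [contradiction | discriminate | split; auto; lia | lia].
Defined.

Lemma INC_nat_ars : INC nat_ars.
Proof. exists (fun n => n); simpl; intros; lia. Qed.

(** Walking backwards from 0 in [Z], [f] drops by at least one per step, which is impossible for
    more than [f (inr 0)] steps. *)
Lemma not_INC_nat_Z_ars : not_INC nat_Z_ars.
Proof.
  intros [f Hf].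
  assert (H : forall n : nat,
             (f (inr (- Z.of_nat n)) + n <= f (inr 0%Z))%nat).
  { induction n as [|n IH]; [simpl; lia | ].
    assert (Hs : - Z.of_nat n = - Z.of_nat (S n) + 1) by lia.
    pose proof (Hf (inr (- Z.of_nat (S n))) (inr (- Z.of_nat n)) Hs); lia. }
  specialize (H (S (f (inr 0%Z)))); lia.
Qed.

Close Scope Z_scope.

Theorem theorem3p18 :
  ~ generalised_first_order INC /\ ~ generalised_first_order not_INC.
Proof.
  split; intros H.
  - apply not_INC_nat_Z_ars.
    exact (generalised_first_order_line_system _ H nat_line_system
             nat_Z_line_system INC_nat_ars).
  - refine (generalised_first_order_line_system _ H nat_Z_line_system
              nat_line_system not_INC_nat_Z_ars _).
    exact INC_nat_ars.
Qed.
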